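(* Let $K_1,\dots,K_n\in\mathcal F_0$. (i) For $p\ge0$, $\;as_p(K_1,\dots,K_n)\le G_p^{(\alpha)}(K_1,\dots,K_n)$ for $\alpha=1,2,3$. (ii) For $-n<p<0$, $\;as_p(K_1,\dots,K_n)\ge G_p^{(\alpha)}(K_1,\dots,K_n)$ for $\alpha=1,2,3$. (iii) For $p<-n$, $\;as_p(K_1,\dots,K_n)\ge G_p^{(\alpha)}(K_1,\dots,K_n)$ for $\alpha=1,3$, and $as_p^{(1)}(K_1,\dots,K_n)\ge G_p^{(\alpha)}(K_1,\dots,K_n)$ for $\alpha=1,2,3$.
   Context: Notation in $\mathbb R^n$: $S^{n-1}$ is the unit sphere with spherical measure $\sigma$ and $|\cdot|$ is volume. $\mathcal K_0$ is the set of convex bodies (compact convex sets) containing the origin in their interior. For $K\in\mathcal K_0$: $h_K(u)=\max_{x\in K}\langle x,u\rangle$ and $K^\circ=\{x:\langle x,y\rangle\le1\ \forall y\in K\}$, with radial function $\rho_{K^\circ}=1/h_K$ on $S^{n-1}$. $\mathcal F_0$ is the set of $K\in\mathcal K_0$ whose surface area measure $S(K,\cdot)$ on $S^{n-1}$ is absolutely continuous with respect to $\sigma$, with density $f_K$ (curvature function); $f_p(K,u)=h_K(u)^{1-p}f_K(u)$ for $p\in\mathbb R$. For $\mathbf K=(K_1,\dots,K_n)\in\mathcal F_0^n$ and $\mathbf L=(L_1,\dots,L_n)\in\mathcal K_0^n$, $$V_p(\mathbf K;\mathbf L)=\frac1n\int_{S^{n-1}}\prod_{i=1}^n\big[h_{L_i}(u)^pf_p(K_i,u)\big]^{\frac1n}d\sigma(u),\qquad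 \widetilde V(\mathbf L^\circ)=\frac1n\int_{S^{n-1}}\prod_{i=1}^n\rho_{L_i^\circ}(u)\,d\sigma(u).$$ Mixed $L_p$ geominimal surface areas. For $p=0$ and $\alpha=1,2,3$: $G_0^{(\alpha)}(K_1,\dots,K_n)=\int_{S^{n-1}}\prod_{i=1}^n[f_{K_i}(u)h_{K_i}(u)]^{\frac1n}d\sigma(u)$. For $p>0$: $$G_p^{(1)}(K_1,\dots,K_n)=\inf_{L\in\mathcal K_0}\Big\{nV_p(\mathbf K;L,\dots,L)^{\frac n{n+p}}|L^\circ|^{\frac p{n+p}}\Big\},$$ $$G_p^{(2)}(K_1,\dots,K_n)=\inf_{\mathbf L\in\mathcal K_0^n}\Big\{nV_p(\mathbf K;\mathbf L)^{\frac n{n+p}}\prod_{i=1}^n|L_i^\circ|^{\frac p{(n+p)n}}\Big\},$$ $$G_p^{(3)}(K_1,\dots,K_n)=\inf_{\mathbf L\in\mathcal K_0^n}\Big\{nV_p(\mathbf K;\mathbf L)^{\frac n{n+p}}\widetilde V(\mathbf L^\circ)^{\frac p{n+p}}\Big\}.$$ For $p<0$, $p\ne-n$, the same formulas with each $\inf$ replaced by $\sup$. Mixed $p$-affine surface areas. $\mathcal S_0$ is the set of sets $L\subset\mathbb R^n$, star-convex about $0$, whose radial function $\rho_L(u)=\max\{\lambda\ge0:\lambda u\in L\}$, $u\in S^{n-1}$, is positive and continuous. For $\mathbf L\in\mathcal S_0^n$ put $V_p(\mathbf K;\mathbf L^\circ)=\frac1n\int_{S^{n-1}}\prod_{i=1}^n[\rho_{L_i}(u)^{-p}f_p(K_i,u)]^{\frac1n}d\sigma(u)$.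 For $K_1,\dots,K_n\in\mathcal F_0$: $as_0(K_1,\dots,K_n)=\int_{S^{n-1}}\prod_{i=1}^n[f_{K_i}(u)h_{K_i}(u)]^{\frac1n}d\sigma(u)$; for $p>0$, $$as_p(K_1,\dots,K_n)=\inf_{L\in\mathcal S_0}\Big\{nV_p(\mathbf K;L^\circ,\dots,L^\circ)^{\frac n{n+p}}|L|^{\frac p{n+p}}\Big\};$$ for $p<0$, $p\ne-n$, the same with $\sup$ in place of $\inf$; and for $p<-n$, $$as_p^{(1)}(K_1,\dots,K_n)=\sup_{\mathbf L\in\mathcal S_0^n}\Big\{nV_p(\mathbf K;\mathbf L^\circ)^{\frac n{n+p}}\prod_{i=1}^n|L_i|^{\frac p{(n+p)n}}\Big\}.$$ Infima and suprema are taken in $[0,+\infty]$, with $0^a=+\infty$ for $a<0$. *)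

(* Defs.v *)
From HB Require Import structures.
From mathcomp Require Import all_boot all_order all_algebra.
From mathcomp Require Import all_classical all_reals all_analysis measurable_realfun.
Set Implicit Arguments.
Unset Strict Implicit.
Unset Printing Implicit Defensive.
Import Order.TTheory GRing.Theory Num.Theory.
Import numFieldNormedType.Exports.
Local Open Scope classical_set_scope.
Local Open Scope ring_scope.

Definition rV_display : measure_display.
Proof. exact: default_measure_display. Qed.

Section borel_rV.
Context {R : realType} {n : nat}.

Definition borel_rV : set (set 'rV[R]_n) := <<s [set U : set 'rV[R]_n | open U] >>.

Let borel_rV0 : borel_rV set0.
Proof. exact: sigma_algebra0. Qed.

Let borel_rVC A : borel_rV A -> borel_rV (~` A).
Proof. exact: sigma_algebraC. Qed.

Let borel_rV_bigcup (F : (set 'rV[R]_n)^nat) :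
  (forall i, borel_rV (F i)) -> borel_rV (\bigcup_i F i).
Proof. exact: sigma_algebra_bigcup. Qed.

HB.instance Definition _ := @isMeasurable.Build rV_display 'rV[R]_n
  borel_rV borel_rV0 borel_rVC borel_rV_bigcup.

Lemma open_measurable_rV (U : set 'rV[R]_n) : open U -> measurable U.
Proof. exact: sub_sigma_algebra. Qed.

Lemma measurable_coord (i : 'I_n) :
  measurable_fun [set: 'rV[R]_n] (fun x : 'rV[R]_n => x 0 i).
Proof.
apply: (measurability _ (RGenOpens.measurableE R)).
move=> _ [_ [a [b ->] <-]]; rewrite setTI; apply: open_measurable_rV.
have /continuousP cont : continuous (fun x : 'rV[R]_n => x 0 i : R).
  exact: coord_continuous.
exact/cont/interval_open.
Qed.

Let box (q : 'rV[rat]_n * rat) : set 'rV[R]_n :=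
  [set x | forall i, `|x 0 i - ratr (q.1 0 i)| < ratr q.2].

Let open_boxE (U : set 'rV[R]_n) : open U ->
  U = \bigcup_(q in [set q | box q `<=` U]) box q.
Proof.
move=> oU; apply/seteqP; split => [x Ux|x [q qU] /qU//].
have /nbhs_ballP[e /= e0 xeU] : nbhs x U by exact: open_nbhs_nbhs.
have [r] : exists r : rat, ratr r \in `]0, (e / 2)%R[.
  by apply: rat_in_itvoo; rewrite divr_gt0.
rewrite in_itv/= => /andP[r0 re].
have /choice[q xq] : forall i : 'I_n,
    exists q : rat, ratr q \in `](x 0 i - ratr r)%R, (x 0 i + ratr r)%R[.
  by move=> i; apply: rat_in_itvoo; rewrite ltrD2l gtrN.
have qE i : ratr ((\row_j q j) 0 i) \in `](x 0 i - ratr r), (x 0 i + ratr r)[.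
  by rewrite mxE.
exists (\row_j q j, r) => /= [y yq|i]; last first.
  by have := qE i; rewrite in_itv/= ltr_distlC.
apply: xeU; split=> // i j; rewrite ord1 -ball_normE/= (splitr e).
rewrite -(subrKA (ratr ((\row_j q j) 0 j))) (le_lt_trans (ler_normD _ _))//.
rewrite ltrD// (lt_trans _ re)//; last by rewrite distrC; exact: yq.
by rewrite ltr_distlC; have := qE j; rewrite in_itv.
Qed.

Lemma measurable_fun_rVP d (T : measurableType d) (f : T -> 'rV[R]_n) :
  (forall i, measurable_fun [set: T] (fun t => f t 0 i)) ->
  measurable_fun [set: T] f.
Proof.
move=> mf; apply: (@measurability _ _ _ _ _ _ [set U : set 'rV[R]_n | open U]) => //.
move=> _ [U oU <-]; rewrite setTI (open_boxE oU) preimage_bigcup bigcup_mkcond.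
apply: countable_bigcupT_measurable => [|q]; first exact: countableP.
case: ifPn => // _.
rewrite (_ : _ @^-1` _ = \bigcap_(i in [set: 'I_n]) (fun t => f t 0 i) @^-1`
    `](ratr (q.1 0 i) - ratr q.2)%R, (ratr (q.1 0 i) + ratr q.2)%R[%classic).
  apply: fin_bigcap_measurable => // i _; rewrite -[X in measurable X]setTI.
  exact: mf.
apply/seteqP; split => t /= tq i => [_|]; have := tq i; rewrite /= in_itv/=.
  by rewrite ltr_distl.
by move=> /(_ Logic.I); rewrite ltr_distl.
Qed.

End borel_rV.

Section lebesgue_rV.
Context {R : realType}.

Definition cons_rV n (z : measurableTypeR R * 'rV[R]_n) : 'rV[R]_(1 + n) :=
  row_mx (z.1 : R)%:M z.2.

Lemma measurable_cons_rV n : measurable_fun [set: measurableTypeR R * 'rV[R]_n] (@cons_rV n).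
Proof.
apply: measurable_fun_rVP => i; case: (splitP i) => j ij.
  rewrite (_ : (fun _ => _) = fst); first exact: measurable_fst.
  apply/funext => z /=.
  rewrite (_ : i = lshift n j); last exact/val_inj.
  by rewrite row_mxEl ord1 mxE.
rewrite (_ : (fun _ => _) = (fun x : 'rV[R]_n => x 0 j) \o snd).
  by apply: measurableT_comp => //; exact: measurable_coord.
apply/funext => z /=; rewrite (_ : i = rshift 1 j) ?row_mxEr//.
exact/val_inj.
Qed.

Section cons_measure.
Context {n : nat} (mu : {sigma_finite_measure set 'rV[R]_n -> \bar R}).

Definition cons_measure (A : set 'rV[R]_(1 + n)) : \bar R :=
  (@lebesgue_measure R \x mu)%E (@cons_rV n @^-1` A).

Let measurable_preimage (A : set 'rV[R]_(1 + n)) :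
  measurable A -> measurable (@cons_rV n @^-1` A).
Proof.
by move=> mA; rewrite -[X in measurable X]setTI; exact: measurable_cons_rV.
Qed.

Let cons_measure0 : cons_measure set0 = 0%E.
Proof. by rewrite /cons_measure preimage_set0 measure0. Qed.

Let cons_measure_ge0 A : (0 <= cons_measure A)%E.
Proof. exact: measure_ge0. Qed.

Let cons_measure_sigma_additive : semi_sigma_additive cons_measure.
Proof.
move=> F mF tF mUF; rewrite /cons_measure preimage_bigcup.
apply: measure_semi_sigma_additive.
- by move=> k; exact: measurable_preimage.
- apply/trivIsetP => i j _ _ ij; rewrite -preimage_setI.
  by move/trivIsetP : tF => /(_ _ _ _ _ ij) ->//; rewrite preimage_set0.
- by rewrite -preimage_bigcup; exact: measurable_preimage.
Qed.

HB.instance Definition _ := isMeasure.Build _ _ _ cons_measure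
  cons_measure0 cons_measure_ge0 cons_measure_sigma_additive.

Let uncons_rV (x : 'rV[R]_(1 + n)) : measurableTypeR R * 'rV[R]_n := (x 0 0, rsubmx x).

Let measurable_uncons_rV : measurable_fun [set: 'rV[R]_(1 + n)] uncons_rV.
Proof.
apply/measurable_fun_pairP; split => /=; first exact: measurable_coord.
apply: measurable_fun_rVP => i.
rewrite (_ : (fun _ => _) = fun x : 'rV[R]_(1 + n) => x 0 (rshift 1 i)).
  exact: measurable_coord.
by apply/funext => x; rewrite mxE.
Qed.

Let cons_measure_sigma_finite : sigma_finite [set: 'rV[R]_(1 + n)] cons_measure.
Proof.
have /sigma_finiteP[F [FT ndF Foo]] := sigma_finiteT (@lebesgue_measure R).
have /sigma_finiteP[G [GT ndG Goo]] := sigma_finiteT mu.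
have consK : uncons_rV \o @cons_rV n = id.
  apply/funext => -[x v]; rewrite /uncons_rV /cons_rV /=; congr pair.
    have -> : 0 = lshift n 0 :> 'I_(1 + n) by exact/val_inj.
    by rewrite row_mxEl mxE.
  by rewrite row_mxKr.
exists (fun k => uncons_rV @^-1` (F k `*` G k)).
  apply/esym; rewrite -subTset => x _; have [i _ Fi] : (\bigcup_k F k) (x 0 0).
    by rewrite -FT.
  have [j _ Gj] : (\bigcup_k G k) (rsubmx x : 'rV[R]_n) by rewrite -GT.
  exists (maxn i j) => //; split => /=.
    by move: Fi; apply/subsetPset/ndF/leq_maxl.
  by move: Gj; apply/subsetPset/ndG/leq_maxr.
move=> k; have [mF Fk] := Foo k; have [mG Gk] := Goo k.
have mFG : measurable (F k `*` G k) by exact: measurableX.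
split; first by rewrite -[X in measurable X]setTI; exact: measurable_uncons_rV.
rewrite /cons_measure -comp_preimage consK product_measure1E//.
by rewrite lte_mul_pinfty// ge0_fin_numE.
Qed.

HB.instance Definition _ := Measure_isSigmaFinite.Build _ _ _ cons_measure
  cons_measure_sigma_finite.

End cons_measure.

(* n-fold product of the one-dimensional Lebesgue measure *)
Fixpoint lebesgue_rV n : {sigma_finite_measure set 'rV[R]_n -> \bar R} :=
  match n with
  | 0 => \d_(0 : 'rV[R]_0)
  | n'.+1 => cons_measure (lebesgue_rV n')
  end.

End lebesgue_rV.

Section euclidean.
Context {R : realType} {n : nat}.
Implicit Types (x y u : 'rV[R]_n) (K L : set 'rV[R]_n).

Definition dotp x y : R := \sum_i x 0 i * y 0 i.

(* The library norm on 'rV[R]_n is the sup norm, which induces the same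
   topology. *)
Definition enorm x : R := Num.sqrt (dotp x x).

Definition sphere : set 'rV[R]_n := [set u | enorm u = 1].

Definition volume : set 'rV[R]_n -> \bar R := lebesgue_rV n.

Definition support_fun K u : R := sup [set dotp x u | x in K].

Definition polar K : set 'rV[R]_n := [set x | forall y, K y -> dotp x y <= 1].

Definition radial_set L u : set R := [set l | 0 <= l /\ L (l *: u)].

Definition radial_fun L u : R := sup (radial_set L u).

Definition convex_bodies0 : set (set 'rV[R]_n) :=
  [set K | [/\ convex_set (K : set (convex_lmodType 'rV[R]_n)),
               compact K & (K°) 0]].

Definition star_bodies0 : set (set 'rV[R]_n) :=
  [set L | [/\ forall x (t : R), L x -> 0 <= t <= 1 -> L (t *: x),
      (* the supremum defining the radial function is a maximum *)
      forall u, sphere u ->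
        radial_set L u (radial_fun L u) /\
        ubound (radial_set L u) (radial_fun L u),
      forall u, sphere u -> 0 < radial_fun L u &
      {within sphere, continuous (radial_fun L)}]].

End euclidean.
Arguments sphere {R n}.
Arguments convex_bodies0 {R n}.
Arguments star_bodies0 {R n}.

Section spherical_measure.
Context {R : realType} {n : nat}.

Definition cone (A : set 'rV[R]_n) : set 'rV[R]_n :=
  [set x | 0 < enorm x <= 1 /\ A ((enorm x)^-1 *: x)].

(* Spherical Lebesgue measure, as a Borel measure on R^n carried by the unit
   sphere: sigma(A) = n |{t u : u \in A, 0 < t <= 1}|. *)
Definition spherical_measure (A : set 'rV[R]_n) : \bar R :=
  (n%:R%:E * volume (cone A))%E.

Lemma measurable_enorm : measurable_fun [set: 'rV[R]_n] enorm.
Proof.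
rewrite (_ : enorm = Num.sqrt \o (fun x : 'rV[R]_n => dotp x x))//.
apply: measurableT_comp.
  by apply: continuous_measurable_fun; exact: sqrt_continuous.
by apply: measurable_sum => i; apply: measurable_funM; exact: measurable_coord.
Qed.

Lemma measurable_cone (A : set 'rV[R]_n) : measurable A -> measurable (cone A).
Proof.
move=> mA; rewrite (_ : cone A = (enorm @^-1` `]0%R, 1%R]) `&`
    ((fun x => (enorm x)^-1 *: x) @^-1` A)); last first.
  by apply/seteqP; split => x; rewrite /cone /= in_itv.
apply: measurableI; rewrite -[X in measurable X]setTI.
  exact: measurable_enorm.
suff : measurable_fun [set: 'rV[R]_n] (fun x : 'rV[R]_n => (enorm x)^-1 *: x).
  exact.
apply: measurable_fun_rVP => i.
rewrite (_ : (fun _ => _) = fun x : 'rV[R]_n => (enorm x `^ (-1)) * x 0 i).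
  apply: measurable_funM; last exact: measurable_coord.
  exact: measurableT_comp (measurable_powR (-1)) measurable_enorm.
by apply/funext => x; rewrite mxE powR_inv1 ?sqrtr_ge0.
Qed.

Let spherical_measure0 : spherical_measure set0 = 0%E.
Proof.
have cone0 : cone set0 = set0 by apply/seteqP; split => x [].
by rewrite /spherical_measure cone0 /volume measure0 mule0.
Qed.

Let spherical_measure_ge0 A : (0 <= spherical_measure A)%E.
Proof. by rewrite mule_ge0. Qed.

Let spherical_measure_sigma_additive : semi_sigma_additive spherical_measure.
Proof.
move=> F mF tF mUF.
have coneU : cone (\bigcup_i F i) = \bigcup_i cone (F i).
  by apply/seteqP; split => [x [x1 [i _ Fi]]|x [i _ [x1 Fi]]];
    [exists i|split => //; exists i].
rewrite /spherical_measure coneU.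
pose m : {measure set 'rV[R]_n -> \bar R} :=
  mscale (NngNum (ler0n R n)) (lebesgue_rV n).
apply: (@measure_semi_sigma_additive _ _ _ m (fun i => cone (F i))).
- by move=> i; exact: measurable_cone.
- apply/trivIsetP => i j _ _ ij; apply/seteqP; split => // x [[_ Fi] [_ Fj]].
  have /trivIsetP/(_ i j Logic.I Logic.I ij) Fij0 := tF.
  have : (F i `&` F j) ((enorm x)^-1 *: x) by split.
  by rewrite Fij0.
- by rewrite -coneU; exact: measurable_cone.
Qed.

HB.instance Definition _ := isMeasure.Build _ _ _ spherical_measure
  spherical_measure0 spherical_measure_ge0 spherical_measure_sigma_additive.

End spherical_measure.

Section hausdorff_measure.
Context {R : realType} {n : nat}.
Local Open Scope ereal_scope.

Definition ediam (U : set 'rV[R]_n) : \bar R :=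
  ereal_sup [set (enorm (x - y))%:E | x in U & y in U].

Definition unit_ball_volume m : \bar R :=
  volume [set x : 'rV[R]_m | (enorm x <= 1)%R].

(* The empty set is singled out so that H^0 is the counting measure. *)
Definition hausdorff_gauge (m : nat) (U : set 'rV[R]_n) : \bar R :=
  if U == set0 then 0
  else unit_ball_volume m * ((fine (ediam U) / 2) ^+ m)%:E.

Definition hausdorff_premeasure (m : nat) (delta : R) (A : set 'rV[R]_n) :=
  ereal_inf [set \sum_(0 <= i <oo) hausdorff_gauge m (U i) |
    U in [set U : (set 'rV[R]_n)^nat |
      A `<=` \bigcup_i U i /\ forall i, ediam (U i) <= delta%:E]].

(* Normalized so that H^m agrees with the volume of R^m *)
Definition hausdorff_measure (m : nat) (A : set 'rV[R]_n) : \bar R :=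
  ereal_sup [set hausdorff_premeasure m delta A |
    delta in [set delta : R | (0 < delta)%R]].

End hausdorff_measure.

Section curvature.
Context {R : realType} {n : nat}.
Implicit Types (K : set 'rV[R]_n) (p : R).

Definition boundary K : set 'rV[R]_n := closure K `\` K°.

(* Boundary points of K having an outer unit normal in A *)
Definition reverse_spherical_image K (A : set 'rV[R]_n) : set 'rV[R]_n :=
  [set x | boundary K x /\
    exists u, [/\ sphere u, A u & dotp x u = support_fun K u]].

Definition surface_area_measure K (A : set 'rV[R]_n) : \bar R :=
  hausdorff_measure n.-1 (reverse_spherical_image K A).

Definition convex_bodiesF0 : set (set 'rV[R]_n) :=
  [set K | convex_bodies0 K /\ surface_area_measure K `<< spherical_measure].

Definition is_curvature_fun K (f : 'rV[R]_n -> R) : Prop :=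
  [/\ measurable_fun sphere f,
      forall u, sphere u -> 0 <= f u &
      forall A, measurable A -> A `<=` sphere ->
        surface_area_measure K A = (\int[spherical_measure]_(u in A) (f u)%:E)%E].

(* For K in convex_bodiesF0 such a density exists by the Radon-Nikodym theorem
   and is unique almost everywhere; one version is selected. *)
Definition curvature_fun K : 'rV[R]_n -> R :=
  xget (fun=> 0) [set f | is_curvature_fun K f].

Definition Lp_curvature_fun p K (u : 'rV[R]_n) : R :=
  support_fun K u `^ (1 - p) * curvature_fun K u.

End curvature.
Arguments convex_bodiesF0 {R n}.

(* Powers on [0, +oo], with 0^a = +oo and (+oo)^a = 0 for a < 0, unlike the
   library's poweR *)
Definition epow {R : realType} (x : \bar R) (a : R) : \bar R :=
  if a < 0 then
    if x == 0%E then +oo%E else if x == +oo%E then 0%E else poweR x a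
  else poweR x a.

Section mixed_areas.
Context {R : realType} {n : nat}.
Implicit Types (K L : 'I_n -> set 'rV[R]_n) (p : R).
Local Open Scope ereal_scope.

Local Notation N := (n%:R : R)%R.

Definition Vp p K L : \bar R := N^-1%:E *
  \int[spherical_measure]_(u in sphere)
    (\prod_(i < n) (support_fun (L i) u `^ p * Lp_curvature_fun p (K i) u)
       `^ N^-1)%R%:E.

(* V_p(K; L^o) for star bodies L *)
Definition Vp_polar p K L : \bar R := N^-1%:E *
  \int[spherical_measure]_(u in sphere)
    (\prod_(i < n) (radial_fun (L i) u `^ (- p) * Lp_curvature_fun p (K i) u)
       `^ N^-1)%R%:E.

(* The dual mixed volume of L_1^o, ..., L_n^o *)
Definition dual_mixed_volume_polar L : \bar R := N^-1%:E *
  \int[spherical_measure]_(u in sphere)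
    (\prod_(i < n) radial_fun (polar (L i)) u)%R%:E.

(* Common value of all the mixed areas at p = 0 *)
Definition mixed_area0 K : \bar R :=
  \int[spherical_measure]_(u in sphere)
    (\prod_(i < n) (curvature_fun (K i) u * support_fun (K i) u) `^ N^-1)%R%:E.

Definition inf_or_sup p (S : set (\bar R)) : \bar R :=
  if (0 < p)%R then ereal_inf S else ereal_sup S.

Definition geominimal1 p K : \bar R :=
  if p == 0%R then mixed_area0 K else
  inf_or_sup p [set N%:E * epow (Vp p K (fun=> L)) (N / (N + p))
                   * epow (volume (polar L)) (p / (N + p))
             | L in convex_bodies0].

Definition geominimal2 p K : \bar R :=
  if p == 0%R then mixed_area0 K else
  inf_or_sup p [set N%:E * epow (Vp p K L) (N / (N + p))
                   * \prod_(i < n) epow (volume (polar (L i))) (p / ((N + p) * N))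
             | L in [set L : 'I_n -> set 'rV[R]_n | forall i, convex_bodies0 (L i)]].

Definition geominimal3 p K : \bar R :=
  if p == 0%R then mixed_area0 K else
  inf_or_sup p [set N%:E * epow (Vp p K L) (N / (N + p))
                   * epow (dual_mixed_volume_polar L) (p / (N + p))
             | L in [set L : 'I_n -> set 'rV[R]_n | forall i, convex_bodies0 (L i)]].

Definition affine_area p K : \bar R :=
  if p == 0%R then mixed_area0 K else
  inf_or_sup p [set N%:E * epow (Vp_polar p K (fun=> L)) (N / (N + p))
                   * epow (volume L) (p / (N + p))
             | L in star_bodies0].

(* Only meant for p < - n *)
Definition affine_area1 p K : \bar R :=
  ereal_sup [set N%:E * epow (Vp_polar p K L) (N / (N + p))
                   * \prod_(i < n) epow (volume (L i)) (p / ((N + p) * N))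
            | L in [set L : 'I_n -> set 'rV[R]_n | forall i, star_bodies0 (L i)]].

End mixed_areas.

(* Main.v *)
Require Import Defs.
From mathcomp Require Import all_boot all_order all_algebra.
From mathcomp Require Import all_classical all_reals all_analysis.
From mathcomp Require Import measurable_realfun.
Import Order.TTheory GRing.Theory Num.Theory.
Import numFieldNormedType.Exports.
Local Open Scope classical_set_scope.
Local Open Scope ring_scope.

(** To convex bodies L_1, ..., L_n associate the star body M on which the
    geometric mean of the support functions h_{L_i} is at most 1, so that
    rho_M ^ n is the product of the radial functions of the L_i^o. Then
    V_p(K; M^o, ..., M^o) = V_p(K; L) and, in polar coordinates, |M| is the dual
    mixed volume of the L_i^o: every competitor of G_p^(3) is a competitor of
    as_p. For L_1 = ... = L_n = L the body M is L^o, which gives G_p^(1).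
    For G_p^(2), Hoelder's inequality bounds |M| by the geometric mean of the
    |L_i^o|; the sign of p / (n + p) makes this the right inequality for p > - n.
    For p < - n it is the wrong one, but the L_i^o themselves are competitors of
    as_p^(1). *)

(** * Lebesgue measure under dilations *)

Section dilation.
Context {R : realType}.
Local Open Scope ereal_scope.

Lemma measurable_scale n (t : R) :
  measurable_fun [set: 'rV[R]_n] (fun x : 'rV[R]_n => t *: x)%R.
Proof.
apply: measurable_fun_rVP => i.
rewrite (_ : (fun _ => _) = fun x : 'rV[R]_n => (t * x 0 i)%R).
  by apply: measurable_funM => //; exact: measurable_coord.
by apply/funext => x; rewrite mxE.
Qed.

(** The left-hand side is a measure in [A], namely a rescaled pushforward. It has the right value on
    half-open intervals, and these determine Lebesgue measure. *)
Lemma lebesgue_measureZ (t : R) (A : set (measurableTypeR R)) :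
  (0 < t)%R -> measurable A ->
  t%:E * lebesgue_measure (( *%R t) @^-1` A) = lebesgue_measure A.
Proof.
move=> t0 mA.
pose f : measurableTypeR R -> measurableTypeR R := *%R t.
have mf : measurable_fun setT f by exact: mulrl_measurable.
pose m : {measure set (measurableTypeR R) -> \bar R} :=
  mscale (NngNum (ltW t0)) (pushforward (@lebesgue_measure R) f).
rewrite [RHS](@lebesgue_measure_unique _ (m mf))//= => _ [[a b]] _ <-.
rewrite /m/= /mscale/= /pushforward.
rewrite (_ : _ @^-1` _ = `](t^-1 * a)%R, (t^-1 * b)%R]%classic).
  rewrite /= !lebesgue_measure_itv/= !lte_fin ltr_pM2l ?invr_gt0//.
  case: ifPn => _; last by rewrite mule0.
  by rewrite -!EFinD -EFinM -mulrBr mulVKf// gt_eqF.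
by apply/seteqP; split => x /=; rewrite !in_itv/= ltr_pdivrMl// ler_pdivlMl.
Qed.

(** Induction on the dimension: both sides are measures on the product of a line with the
    lower-dimensional space, and by the one-dimensional case and the induction hypothesis they agree
    on rectangles. *)
Lemma volumeZ n (t : R) (A : set 'rV[R]_n) : (0 < t)%R -> measurable A ->
  (t ^+ n)%:E * volume ((fun x => t *: x)%R @^-1` A) = volume A.
Proof.
move=> t0; rewrite /volume; elim: n => [|n IHn] in A *; move=> mA.
  (* In dimension 0 there is a single vector, so scaling is the identity. *)
  rewrite expr0 mul1e; congr (_ _).
  by apply/funext => x /=; congr (A _); rewrite [LHS]thinmx0 [RHS]thinmx0.
rewrite /= /cons_measure.
pose g (z : measurableTypeR R * 'rV[R]_n) : measurableTypeR R * 'rV[R]_n :=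
  ((t * z.1)%R, t *: z.2)%R.
have mg : measurable_fun [set: measurableTypeR R * 'rV[R]_n] g.
  apply/measurable_fun_pairP; split => /=.
    exact: (measurableT_comp (mulrl_measurable t) measurable_fst).
  exact: (measurableT_comp (measurable_scale n t) measurable_snd).
pose m : {measure set (measurableTypeR R * 'rV[R]_n) -> \bar R} :=
  mscale (NngNum (exprn_ge0 n.+1 (ltW t0)))
    (pushforward (@lebesgue_measure R \x lebesgue_rV n) g).
rewrite [RHS](@product_measure_unique _ _ _ _ _ _ _ (m mg)).
- rewrite /m/= /mscale/= /pushforward; congr (_ * (product_measure1 _ _ _)).
  apply/funext => z /=.
  suff -> : (t *: cons_rV z = cons_rV (g z))%R by [].
  by rewrite /cons_rV scale_row_mx scale_scalar_mx.
- move=> B C mB mC; rewrite /m/= /mscale/= /pushforward.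
  rewrite (_ : _ @^-1` _ = (( *%R t) @^-1` B) `*` ((fun x => t *: x)%R @^-1` C)) //.
  rewrite product_measure1E.
  - rewrite exprS EFinM -(IHn C)// -(lebesgue_measureZ _ _ t0 mB).
    by rewrite muleACA.
  - by rewrite -[X in measurable X]setTI; exact: mulrl_measurable.
  - by rewrite -[X in measurable X]setTI; exact: measurable_scale.
- rewrite -[X in measurable X]setTI; exact: measurable_cons_rV.
Qed.

End dilation.

(** * The Euclidean norm and integration in polar coordinates *)

Section polar_coordinates.
Context {R : realType}.

Lemma enorm_ge0 n (x : 'rV[R]_n) : 0 <= enorm x.
Proof. exact: sqrtr_ge0. Qed.

Lemma enorm_eq0 n (x : 'rV[R]_n) : (enorm x == 0) = (x == 0).
Proof.
rewrite /enorm sqrtr_eq0 /dotp.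
have s0 i : 0 <= x 0 i * x 0 i by rewrite -expr2 sqr_ge0.
apply/idP/eqP => [|->]; last by rewrite big1// => i _; rewrite mxE mul0r.
move=> x0; apply/rowP => i; rewrite mxE; apply/eqP.
have xx : \sum_i x 0 i * x 0 i = 0 by apply/le_anti; rewrite x0 sumr_ge0.
have /eqP : x 0 i * x 0 i = 0 by apply: psumr_eq0P xx _ _ => // j _; exact: s0.
by rewrite mulf_eq0 orbb.
Qed.

Lemma measurable_set0_rV n : measurable [set 0 : 'rV[R]_n].
Proof.
rewrite (_ : [set _] = enorm @^-1` [set 0]).
  by rewrite -[X in measurable X]setTI; exact: measurable_enorm.
by apply/seteqP; split => x /= /eqP; [rewrite -enorm_eq0|rewrite enorm_eq0]; move/eqP.
Qed.

(** The first coordinate already confines the point to a null set of the line. In dimension 0 the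
    volume is a Dirac mass, whence the condition on [n]. *)
Lemma volume_set10 n : (0 < n)%N -> volume [set 0 : 'rV[R]_n] = 0%E.
Proof.
case: n => // n _; rewrite /volume /= /cons_measure.
rewrite (_ : _ @^-1` _ = [set (0 : measurableTypeR R)] `*` [set (0 : 'rV[R]_n)]).
  rewrite product_measure1E; [|exact: (measurable_set1 (0:R))|exact: measurable_set0_rV].
  by rewrite [X in (X * _)%E](_ : _ = 0%E) ?mul0e//; exact: lebesgue_measure_set1.
apply/seteqP; split => -[a v] /=; rewrite /cons_rV/=.
  move=> av0; have := congr1 (fun x : 'rV[R]_(1 + n) => (lsubmx x, rsubmx x)) av0.
  rewrite /= row_mxKl row_mxKr => -[/matrixP/(_ 0 0)].
  rewrite !mxE eqxx mulr1n => -> ->; split=> //.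
  by apply/rowP => i; rewrite !mxE.
move=> [-> ->]; apply/rowP => i; rewrite mxE.
by case: splitP => j _; rewrite !mxE// mul0rn.
Qed.

Lemma enormZ n (t : R) (x : 'rV[R]_n) : enorm (t *: x) = `|t| * enorm x.
Proof.
rewrite /enorm -sqrtr_sqr -sqrtrM ?sqr_ge0//; congr Num.sqrt.
by rewrite /dotp mulr_sumr; apply: eq_bigr => i _; rewrite !mxE expr2 mulrACA.
Qed.

Lemma sphere_normalize n (x : 'rV[R]_n) : 0 < enorm x -> sphere ((enorm x)^-1 *: x).
Proof.
by move=> x0; rewrite /sphere/= enormZ gtr0_norm ?invr_gt0// mulVf// gt_eqF.
Qed.

Lemma measurable_sphere n : measurable (@sphere R n).
Proof.
rewrite (_ : sphere = @enorm R n @^-1` [set 1])//.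
by rewrite -[X in measurable X]setTI; exact: measurable_enorm.
Qed.

Lemma measurable_fun_inv d (T : measurableType d) (D : set T) (f : T -> R) :
  measurable_fun D f -> measurable_fun D (fun x => (f x)^-1).
Proof.
(* The power function with exponent -1 agrees with inversion on nonnegative reals, so the square is
   inverted and [f x] restores the sign. Where [f x = 0], both sides are 0. *)
move=> mf; rewrite (_ : (fun _ => _) = fun x => f x * (f x ^+ 2) `^ (-1)).
  apply: measurable_funM => //.
  by apply: (measurableT_comp (measurable_powR (-1))); exact: measurable_funX.
apply/funext => x; rewrite powR_inv1 ?sqr_ge0// expr2 invfM mulrA.
by have [->|fx0] := eqVneq (f x) 0; rewrite ?invr0 ?mulr0// divff// mul1r.
Qed.

Lemma exists_expr_bracket (t g : R) : 1 < t -> 1 <= g ->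
  exists j, t ^+ j <= g < t ^+ j.+1.
Proof.
move=> t1 g1.
have ex : exists j, g < t ^+ j.
  (* Bernoulli's inequality in the form [m * (t - 1) <= t ^+ m] makes this exponent large enough.
     The bracket then ends at the least such exponent. *)
  exists (Num.truncn (g / (t - 1))).+1.
  have := truncnS_gt (g / (t - 1)).
  set m := (Num.truncn _).+1; rewrite ltr_pdivrMr ?subr_gt0// => /lt_le_trans; apply.
  elim: m => [|m IH]; first by rewrite mul0r expr0.
  rewrite exprSr -natr1 mulrDl mul1r -[leRHS](subrK (t ^+ m)) addrC.
  rewrite -{2}[t ^+ m]mulr1 -mulrBr lerD// ler_peMl ?subr_ge0 ?(ltW t1)//.
  by rewrite exprn_ege1// ltW.
case: (ex_minnP ex) => -[|j] gj minj.
  by move: gj; rewrite expr0 ltNge g1.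
exists j; rewrite gj andbT leNgt; apply/negP => /minj.
by rewrite ltnn.
Qed.

(** * Volume of the unit sublevel set of a positively homogeneous function *)

Section sublevel.
Context {n : nat} (n_gt0 : (0 < n)%N) (H : 'rV[R]_n -> R) (C : R).
Hypotheses (mH : measurable_fun setT H)
  (HZ : forall l x, 0 < l -> H (l *: x) = l * H x)
  (H_gt0 : forall u, sphere u -> 0 < H u)
  (C_gt0 : 0 < C)
  (HC : forall u, sphere u -> H u <= C).

Let N : R := n%:R.
Let N0 : 0 < N. Proof. by rewrite ltr0n. Qed.

Let mpre (f : 'rV[R]_n -> 'rV[R]_n) A : measurable_fun setT f ->
  measurable A -> measurable (f @^-1` A).
Proof. by move=> mf mA; rewrite -[X in measurable X]setTI; exact: mf. Qed.

Let mpreR (f : 'rV[R]_n -> R) A : measurable_fun setT f ->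
  measurable A -> measurable (f @^-1` A).
Proof. by move=> mf mA; rewrite -[X in measurable X]setTI; exact: mf. Qed.

(** Directions in which the radius [(H u)^-1] lies between two consecutive levels of a geometric
    progression. It starts at [C^-1], a lower bound of the radius on the sphere, so natural
    exponents suffice to cover the sphere. *)
Let piece (t : R) j := [set u : 'rV[R]_n | sphere u /\
  (t ^+ j / C <= (H u)^-1 < t ^+ j.+1 / C)].

Let mpiece t j : measurable (piece t j).
Proof.
rewrite (_ : piece t j =
    sphere `&` (fun u => (H u)^-1) @^-1` `[t ^+ j / C, t ^+ j.+1 / C[).
  apply: measurableI; first exact: measurable_sphere.
  by apply: mpreR; [exact: measurable_fun_inv|exact: measurable_itv].
by apply/seteqP; split => u; rewrite /piece/= in_itv.
Qed.

Let dpiece t : 1 < t -> trivIset setT (piece t).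
Proof.
move=> t1 i j _ _ [u [[_ /andP[ui iu]] [_ /andP[uj ju]]]].
have := le_lt_trans ui ju; have := le_lt_trans uj iu.
rewrite !ltr_pM2r ?invr_gt0// !ltr_eXn2l// !ltnS => ji ij.
by apply/eqP; rewrite eqn_leq ji ij.
Qed.

Let piece_cover t : 1 < t -> sphere = \bigcup_j piece t j.
Proof.
move=> t1; apply/seteqP; split => [u su|u [j _ []//]].
have [j /andP[ju uj]] : exists j, t ^+ j <= C / H u < t ^+ j.+1.
  by apply: exists_expr_bracket => //; rewrite ler_pdivlMr ?mul1r ?HC ?H_gt0.
exists j => //; split => //.
by rewrite ler_pdivrMr// ltr_pdivlMr// mulrC ju.
Qed.

Let sector t j := [set x : 'rV[R]_n |
  [/\ 0 < enorm x, piece t j ((enorm x)^-1 *: x) & H x <= 1]].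

Let mnormalize :
  measurable_fun setT (fun x : 'rV[R]_n => (enorm x)^-1 *: x).
Proof.
apply: measurable_fun_rVP => i.
rewrite (_ : (fun _ => _) = (fun x => (enorm x)^-1 * x 0 i)); last first.
  by apply/funext => x; rewrite mxE.
apply: measurable_funM; last exact: measurable_coord.
by apply: measurable_fun_inv; exact: measurable_enorm.
Qed.

Let msector t j : measurable (sector t j).
Proof.
rewrite (_ : sector t j = enorm @^-1` `]0, +oo[ `&`
  ((fun x : 'rV[R]_n => (enorm x)^-1 *: x) @^-1` piece t j `&` H @^-1` `]-oo, 1])).
  apply: measurableI; first by apply: mpreR => //; exact: measurable_enorm.
  by apply: measurableI; [apply: mpre|apply: mpreR].
by apply/seteqP; split => x; rewrite /sector/= !in_itv/= andbT; [case|case=> ? []].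
Qed.

Let sector_cover t : 1 < t ->
  [set x | H x <= 1] `\` [set 0] = \bigcup_j sector t j.
Proof.
move=> t1; apply/seteqP; split => [x [Hx /eqP x0]|x [j _ [x0 _ Hx]]]; last first.
  by split => //= /eqP; rewrite -enorm_eq0 gt_eqF.
have ex : 0 < enorm x by rewrite lt_neqAle enorm_ge0 eq_sym enorm_eq0 x0.
have := sphere_normalize _ _ ex; rewrite (piece_cover t)// => -[j _ xj].
by exists j.
Qed.

Let dsector t : 1 < t -> trivIset setT (sector t).
Proof.
move=> t1 i j _ _ [x [[_ xi _] [_ xj _]]].
by apply: (dpiece t t1) => //; exists ((enorm x)^-1 *: x).
Qed.

(** The disjoint sectors miss only the origin, which has volume zero. *)
Let volume_sublevelE t : 1 < t ->
  volume [set x | H x <= 1] = (\sum_(0 <= j <oo) volume (sector t j))%E.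
Proof.
move=> t1.
have mH1 : measurable [set x | H x <= 1].
  rewrite (_ : [set _ | _] = H @^-1` `]-oo, 1]); first exact: mpreR.
  by apply/seteqP; split => x; rewrite /= in_itv.
have m0 := measurable_set0_rV n.
rewrite /volume (measureDI _ mH1 m0) [X in (_ + X)%E](_ : _ = 0%E) ?adde0.
  rewrite (sector_cover t)//; apply: measure_semi_bigcup => //.
  - exact: dsector.
  - by rewrite -sector_cover//; exact: measurableD.
apply/eqP; rewrite -measure_le0 -[leRHS](volume_set10 n)//; apply: le_measure.
- by rewrite inE; exact: measurableI.
- by rewrite inE.
- exact: subIsetr.
Qed.

Let lvl (t : R) j := t ^+ j / C.

Let lvl_gt0 t j : 1 < t -> 0 < lvl t j.
Proof. by move=> t1; rewrite divr_gt0// exprn_gt0// (lt_trans _ t1). Qed.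

Let lvlS t j : lvl t j.+1 = t * lvl t j.
Proof. by rewrite /lvl exprS mulrA. Qed.

Let volume_dilated_cone (s : R) A : 0 < s -> measurable A ->
  volume ((fun x : 'rV[R]_n => s^-1 *: x) @^-1` cone A) =
  ((s ^+ n)%:E * volume (cone A))%E.
Proof.
move=> s0 mA; have mcA := measurable_cone mA.
have := volumeZ n s^-1 _ _ mcA; rewrite invr_gt0 => /(_ s0) <-.
by rewrite muleA -EFinM -exprMn divff ?gt_eqF// expr1n mul1e.
Qed.

Let cone_dilate (s : R) A (x : 'rV[R]_n) : 0 < s -> cone A (s^-1 *: x) <->
  0 < enorm x <= s /\ A ((enorm x)^-1 *: x).
Proof.
move=> s0; rewrite /cone/= enormZ gtr0_norm ?invr_gt0// pmulr_rgt0 ?invr_gt0//.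
rewrite ler_pdivrMl// mulr1 invfM invrK scalerA mulrAC mulfV ?gt_eqF// mul1r.
by [].
Qed.

(** Over the piece the radius is at least the lower level, so the cone dilated by that level lies
    inside the sector. *)
Let le_volume_sector t j : 1 < t ->
  (((lvl t j) ^+ n)%:E * volume (cone (piece t j)) <= volume (sector t j))%E.
Proof.
move=> t1; rewrite -volume_dilated_cone ?lvl_gt0//.
apply: le_measure; rewrite ?inE//.
  by apply: mpre; [exact: measurable_scale|exact: measurable_cone].
move=> x /= /cone_dilate; rewrite lvl_gt0// => /(_ isT) [/andP[x0 xs] px].
split => //; have [su /andP[+ _]] := px.
rewrite HZ ?invr_gt0// invfM invrK => h.
have Hx : 0 < H x by have := H_gt0 _ su; rewrite HZ ?invr_gt0// pmulr_rgt0 ?invr_gt0.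
by move: (le_trans xs h); rewrite ler_pdivlMr// ger_pMr.
Qed.

(** Over the piece the radius stays below the next level, so the cone dilated by that level contains
    the sector. *)
Let volume_sector_le t j : 1 < t ->
  (volume (sector t j) <= ((lvl t j.+1) ^+ n)%:E * volume (cone (piece t j)))%E.
Proof.
move=> t1; rewrite -volume_dilated_cone ?lvl_gt0//.
apply: le_measure; rewrite ?inE//.
  by apply: mpre; [exact: measurable_scale|exact: measurable_cone].
move=> x /= [x0 px Hx1]; apply/cone_dilate; first exact: lvl_gt0.
split => //; rewrite x0/=; have [su /andP[_ +]] := px.
rewrite HZ ?invr_gt0// invfM invrK => /ltW; apply: le_trans.
have Hx : 0 < H x by have := H_gt0 _ su; rewrite HZ ?invr_gt0// pmulr_rgt0 ?invr_gt0.
by rewrite ler_peMr ?enorm_ge0// -invr1 lef_pV2 ?posrE.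
Qed.

Let I t j := (N^-1%:E * \int[spherical_measure]_(u in piece t j) ((H u)^-1 ^+ n)%:E)%E.

(** The spherical measure of a set is [n] times the volume of its cone, and the factor [N^-1]
    cancels this [n]. *)
Let I_cst t j (c : R) : 0 <= c ->
  (N^-1%:E * \int[spherical_measure]_(u in piece t j) (c ^+ n)%:E =
  (c ^+ n)%:E * volume (cone (piece t j)))%E.
Proof.
move=> c0; rewrite integral_cst// /spherical_measure muleCA; congr (_ * _)%E.
by rewrite muleA -EFinM mulVf ?mul1e ?gt_eqF.
Qed.

Let mI (D : set 'rV[R]_n) :
  measurable_fun D (fun u => ((H u)^-1 ^+ n)%:E).
Proof.
apply/measurable_EFinP; apply: measurable_funX; apply: measurable_fun_inv.
exact: measurable_funTS.
Qed.

Let le_I t j : 1 < t ->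
  (((lvl t j) ^+ n)%:E * volume (cone (piece t j)) <= I t j)%E.
Proof.
move=> t1; have l0 := lvl_gt0 _ j t1; rewrite -I_cst ?(ltW l0)//.
rewrite lee_wpmul2l ?lee_fin ?invr_ge0 ?(ltW N0)//.
apply: ge0_le_integral => //.
- by move=> u _; rewrite lee_fin exprn_ge0// ltW.
- by move=> u [su /andP[h _]]; rewrite lee_fin lerXn2r// ?nnegrE ?invr_ge0 ltW// H_gt0.
Qed.

Let I_le t j : 1 < t ->
  (I t j <= ((lvl t j.+1) ^+ n)%:E * volume (cone (piece t j)))%E.
Proof.
move=> t1; have l0 := lvl_gt0 _ j.+1 t1; rewrite -I_cst ?(ltW l0)//.
rewrite lee_wpmul2l ?lee_fin ?invr_ge0 ?(ltW N0)//.
apply: ge0_le_integral => //.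
- by move=> u [su _]; rewrite lee_fin exprn_ge0// invr_ge0 ltW ?H_gt0.
- by move=> u [su /andP[_ h]]; rewrite lee_fin lerXn2r// ?nnegrE ?invr_ge0 ltW// H_gt0.
Qed.

Let I_ge0 t j : (0 <= I t j)%E.
Proof.
rewrite mule_ge0 ?lee_fin ?invr_ge0 ?(ltW N0)// integral_ge0// => u [su _].
by rewrite lee_fin exprn_ge0// invr_ge0 ltW ?H_gt0.
Qed.

Let I_sum t : 1 < t ->
  (N^-1%:E * \int[spherical_measure]_(u in sphere) ((H u)^-1 ^+ n)%:E =
   \sum_(0 <= j <oo) I t j)%E.
Proof.
move=> t1; rewrite (piece_cover t)// ge0_integral_bigcup//.
- rewrite nneseriesZl// => j _; apply: integral_ge0 => u [su _].
  by rewrite lee_fin exprn_ge0// invr_ge0 ltW ?H_gt0.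
- move=> u [j _ [su _]].
  by rewrite lee_fin exprn_ge0// invr_ge0 ltW ?H_gt0.
- exact: dpiece.
Qed.

(* Cutting along the levels t ^+ j of the radius, both sides agree up to the
   factor t ^+ n, and t > 1 is arbitrary. *)
Lemma volume_sublevel :
  (volume [set x | (H x <= 1)%R] =
  N^-1%:E * \int[spherical_measure]_(u in sphere) ((H u)^-1 ^+ n)%:E)%E.
Proof.
(* Each inequality is proved up to an arbitrary factor [r < 1]; the ratio [t] of the levels is
   chosen so that [r] absorbs the loss [t ^+ n] between consecutive levels. *)
have root (r : R) : 0 < r < 1 -> exists2 t, 1 < t & t ^+ n = r^-1.
  move=> /andP[r0 r1]; exists (r^-1 `^ N^-1).
    have <- : 1 `^ N^-1 = 1 by rewrite powR1.
    by rewrite gt0_ltr_powR ?nnegrE ?invr_gt0 ?invr_ge0 ?(ltW r0)// invf_gt1.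
  by rewrite -powR_mulrn ?powR_ge0// -powRrM mulVf ?gt_eqF// powRr1// invr_ge0 ltW.
apply/le_anti/andP; split.
  apply/lee_mul01Pr; first exact: measure_ge0.
  move=> r /[dup] /root[t t1 tr] /andP[r0 r1].
  rewrite (volume_sublevelE t)// (I_sum t)// -nneseriesZl//.
  apply: lee_nneseries => j _; first by rewrite mule_ge0 ?lee_fin ?(ltW r0)//.
  apply: le_trans (le_I _ j t1).
  apply: le_trans (lee_wpmul2l _ (volume_sector_le _ j t1)) _.
    by rewrite lee_fin ltW.
  by rewrite lvlS exprMn tr muleA -EFinM mulVKf ?gt_eqF.
apply/lee_mul01Pr; first by rewrite (I_sum 2) ?ltr1n//; exact: nneseries_ge0.
move=> r /[dup] /root[t t1 tr] /andP[r0 r1].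
rewrite (volume_sublevelE t)// (I_sum t)// -nneseriesZl//.
apply: lee_nneseries => j _; first by rewrite mule_ge0 ?lee_fin ?(ltW r0)//.
apply: le_trans (le_volume_sector _ j t1).
apply: le_trans (lee_wpmul2l _ (I_le _ j t1)) _.
  by rewrite lee_fin ltW.
by rewrite lvlS exprMn tr muleA -EFinM mulVKf ?gt_eqF.
Qed.

End sublevel.
End polar_coordinates.

(** * Hoelder's inequality for a product of n functions *)

Section hoelder.
Context {R : realType}.

Lemma prode_gt0 (I : Type) (s : seq I) (P : pred I) (f : I -> \bar R) :
  (forall i, P i -> 0 < f i)%E -> (0 < \prod_(i <- s | P i) f i)%E.
Proof. by move=> f0; elim/big_ind : _ => // x y; exact: mule_gt0. Qed.

(** The inequality between arithmetic and geometric means, applied to the powers [x i ^+ n]. *)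
Lemma prod_le_mean_expr n (x : 'I_n -> R) : (0 < n)%N ->
  (forall i, 0 <= x i) -> \prod_i x i <= (\sum_i x i ^+ n) / n%:R.
Proof.
move=> n0 x0; have mean0 : 0 <= (\sum_i x i ^+ n) / n%:R.
  by rewrite divr_ge0// sumr_ge0// => i _; rewrite exprn_ge0.
rewrite -(ler_pXn2r n0) ?nnegrE ?prodr_ge0// -prodrXl.
have [] := @leif_AGM R _ 'I_n (fun i => x i ^+ n).
  by move=> i _; rewrite exprn_ge0.
by rewrite card_ord.
Qed.

(** When all the integrals on the right are positive and finite, each function is divided by its L^n
    norm, the arithmetic-geometric mean inequality is applied pointwise, and the result is
    integrated. *)
Lemma hoelder_prod d (T : measurableType d) (mu : {measure set T -> \bar R})
    (D : set T) n (f : 'I_n -> T -> R) : (0 < n)%N -> measurable D ->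
  (forall i, measurable_fun D (f i)) ->
  (forall i x, D x -> 0 <= f i x) ->
  (\int[mu]_(x in D) (\prod_i f i x)%:E <=
  \prod_i (\int[mu]_(x in D) (f i x ^+ n)%:E) `^ (n%:R^-1))%E.
Proof.
move=> n0 mD mf f0; set a := fun i => (\int[mu]_(x in D) (f i x ^+ n)%:E)%E.
have N0 : 0 < n%:R^-1 :> R by rewrite invr_gt0 ltr0n.
have a0 i : (0 <= a i)%E.
  by apply: integral_ge0 => x Dx; rewrite lee_fin exprn_ge0// f0.
have mfn i : measurable_fun D (fun x => (f i x ^+ n)%:E).
  by apply/measurable_EFinP; exact: measurable_funX.
have mprod : measurable_fun D (fun x => (\prod_i f i x)%:E).
  by apply/measurable_EFinP; exact: measurable_prod.
have prod0 x : D x -> 0 <= \prod_i f i x.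
  by move=> Dx; apply: prodr_ge0 => i _; exact: f0.
(* If one integral vanishes, then that factor, and with it the product, is zero almost
   everywhere. *)
have [[i ai0]|/forallNP aN0] := pselect (exists i, a i = 0%E).
  rewrite [leLHS](_ : _ = 0%E); first by apply: prode_ge0 => j _; exact: poweR_ge0.
  rewrite [LHS](@ge0_ae_eq_integral _ _ _ _ _ _ (cst 0%E)) ?integral0//.
  have [N [mN N0' DN]] : ae_eq mu D (fun x => (f i x ^+ n)%:E) (cst 0%E).
    apply/ae_eq_integral_abs => //; rewrite -[RHS]ai0; apply: eq_integral => x.
    by rewrite inE => Dx; rewrite gee0_abs// lee_fin exprn_ge0// f0.
  exists N; split => // x /= Nx; apply: DN => /= fx0; apply: Nx => Dx.
  have [/eqP] := fx0 Dx; rewrite expf_eq0 => /andP[_ /eqP fi0].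
  by rewrite (bigD1 i)//= fi0 mul0r.
have agt0 i : (0 < a i)%E by rewrite lt_def a0 andbT; apply/eqP/aN0.
(* The other factors are now positive, so one infinite integral makes the bound infinite. *)
have [[i aioo]|/forallNP aNoo] := pselect (exists i, a i = +oo%E).
  rewrite (bigD1 i)//= -/(a i) aioo poweRyr ?gt_eqF// gt0_mulye ?leey//.
  by apply: prode_gt0 => j _; exact/poweR_gt0/agt0.
have afin i : a i \is a fin_num by rewrite ge0_fin_numE// ltey; apply/eqP/aNoo.
pose r i := fine (a i).
have aE i : a i = (r i)%:E by rewrite fineK.
have r0 i : 0 < r i by rewrite -lte_fin -aE.
pose c i := r i `^ n%:R^-1.
have c0 i : 0 < c i by rewrite powR_gt0.
have cX i : c i ^+ n = r i.
  rewrite -powR_mulrn ?powR_ge0// -powRrM mulVf ?powRr1 ?(ltW (r0 i))//.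
  by rewrite pnatr_eq0 -lt0n.
(* Coefficient of [f i x ^+ n] after the mean inequality for the quotients [f i x / c i] is
   multiplied by the product of the norms [c j]. Each [k i * r i] is one n-th of that product. *)
pose k i := (\prod_j c j) / n%:R / r i.
have k0 i : 0 <= k i.
  by rewrite !divr_ge0 ?(ltW (r0 i))//; apply: prodr_ge0 => j _; exact/ltW.
have fk x : D x -> \prod_i f i x <= \sum_i k i * f i x ^+ n.
  move=> Dx; have := prod_le_mean_expr _ (fun i => f i x / c i) n0.
  rewrite big_split/= prodfV => /(_ (fun i => divr_ge0 (f0 i x Dx) (ltW (c0 i)))).
  have pc0 : 0 < \prod_j c j by apply: prodr_gt0.
  rewrite ler_pdivrMr// => /le_trans; apply; rewrite le_eqVlt; apply/orP; left.
  apply/eqP; rewrite !mulr_suml; apply: eq_bigr => i _.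
  rewrite /k expr_div_n cX [RHS]mulrC -!mulrA; congr (_ * _).
  by rewrite [LHS]mulrA [LHS]mulrC [_^-1 * _^-1]mulrC.
apply: (@le_trans _ _ (\int[mu]_(x in D) (\sum_i (k i)%:E * (f i x ^+ n)%:E))%E).
  apply: ge0_le_integral => //.
  - apply: emeasurable_sum => i _.
    by apply: emeasurable_funM.
  - by move=> x Dx; rewrite sumEFin lee_fin fk.
rewrite ge0_integral_sum//; last 2 first.
- by move=> i; apply: emeasurable_funM.
- by move=> i x Dx; rewrite mule_ge0// lee_fin ?exprn_ge0 ?f0.
under eq_bigr => i _.
  rewrite ge0_integralZl//; last 2 first.
  - by move=> x Dx; rewrite lee_fin exprn_ge0// f0.
  - by rewrite lee_fin.
  rewrite -/(a i) aE -EFinM /k divfK ?gt_eqF//; over.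
rewrite sumEFin; under [leRHS]eq_bigr => i _ do rewrite -/(a i) aE poweR_EFin -/(c i).
rewrite prodEFin lee_fin sumr_const card_ord -[leLHS]mulr_natr divfK//.
by rewrite pnatr_eq0 -lt0n.
Qed.

End hoelder.

(** * Inner product and norms of row vectors *)

Section row_vectors.
Context {R : realType} {n : nat}.
Implicit Types (x y u : 'rV[R]_n).

Lemma coord_le_norm x i : `|x 0 i| <= `|x|.
Proof.
rewrite [leRHS](mx_normrE x).
exact: (le_bigmax _ (fun ij : 'I_1 * 'I_n => `|x ij.1 ij.2|) (0, i)).
Qed.

Lemma coord_le_enorm x i : `|x 0 i| <= enorm x.
Proof.
rewrite /enorm -sqrtr_sqr ler_sqrt; last first.
  by apply: sumr_ge0 => j _; rewrite -expr2 sqr_ge0.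
rewrite /dotp (bigD1 i)//= expr2 lerDl; apply: sumr_ge0 => j _.
by rewrite -expr2 sqr_ge0.
Qed.

Lemma dotpC x y : dotp x y = dotp y x.
Proof. by apply: eq_bigr => i _; rewrite mulrC. Qed.

Lemma dotpZl t x y : dotp (t *: x) y = t * dotp x y.
Proof. by rewrite /dotp mulr_sumr; apply: eq_bigr => i _; rewrite mxE mulrA. Qed.

Lemma dotpZr t x y : dotp x (t *: y) = t * dotp x y.
Proof. by rewrite dotpC dotpZl dotpC. Qed.

Lemma dotpDr x y z : dotp x (y + z) = dotp x y + dotp x z.
Proof. by rewrite /dotp -big_split; apply: eq_bigr => i _; rewrite mxE mulrDr. Qed.

Lemma dotp0l x : dotp 0 x = 0.
Proof. by rewrite /dotp big1// => i _; rewrite mxE mul0r. Qed.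

Lemma dotp_gt0 x : (0 < dotp x x) = (x != 0).
Proof. by rewrite -enorm_eq0 -sqrtr_gt0 lt_def enorm_ge0 andbT. Qed.

Lemma continuous_measurable_rV (f : 'rV[R]_n -> R) :
  continuous f -> measurable_fun [set: 'rV[R]_n] f.
Proof.
move=> /continuousP cf; apply: (measurability _ (RGenOpens.measurableE R)).
move=> _ [_ [a [b ->] <-]]; rewrite setTI; apply: open_measurable_rV.
exact/cf/interval_open.
Qed.

End row_vectors.

(** * Support functions of convex bodies *)

Section support_function.
Context {R : realType} {n : nat} (L : set 'rV[R]_n) (L0 : convex_bodies0 L).
Implicit Types x y u : 'rV[R]_n.

Let L_0 : L 0.
Proof. by have [_ _] := L0; exact: interior_subset. Qed.

Lemma convex_body_coord_bounded :
  exists2 C, 0 < C & forall y i, L y -> `|y 0 i| <= C.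
Proof.
have [_ /compact_bounded[M [_ LM]] _] := L0.
exists (Num.max (M + 1) 1) => [|y i Ly]; first by rewrite lt_max ltr01 orbT.
apply: le_trans (coord_le_norm y i) _; apply: LM => //.
by rewrite lt_max ltrDl ltr01.
Qed.

Lemma dotp_le_norm :
  exists2 C, 0 < C & forall x y, L y -> dotp y x <= C * `|x|.
Proof.
have [C C0 LC] := convex_body_coord_bounded.
(* The norm of [x] is the sup norm, so each of the [n] coordinates contributes at most [C] times it;
   [n.+1] keeps the constant positive in dimension 0 too. *)
exists (n.+1%:R * C) => [|x y Ly]; first by rewrite mulr_gt0.
apply: (@le_trans _ _ (\sum_(i < n) C * `|x|)).
  apply: ler_sum => i _; apply: le_trans (ler_norm _) _.
  by rewrite normrM ler_pM ?LC ?coord_le_norm.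
rewrite sumr_const card_ord -[leLHS]mulr_natl mulrA ler_wpM2r// ler_wpM2r ?(ltW C0)//.
by rewrite ler_nat.
Qed.

Let image0 x : [set dotp y x | y in L] !=set0.
Proof. by exists (dotp 0 x), 0. Qed.

Let has_sup_image x : has_sup [set dotp y x | y in L].
Proof.
split => //; have [C _ LC] := dotp_le_norm.
by exists (C * `|x|) => _ [y Ly <-]; exact: LC.
Qed.

Lemma dotp_le_support x y : L y -> dotp y x <= support_fun L x.
Proof. by move=> Ly; apply: sup_upper_bound => //; exists y. Qed.

Lemma support_le x c : (forall y, L y -> dotp y x <= c) -> support_fun L x <= c.
Proof. by move=> h; apply: ge_sup => // _ [y Ly <-]; exact: h. Qed.

Lemma support_ge0 x : 0 <= support_fun L x.
Proof. by rewrite -(dotp0l x); exact: dotp_le_support. Qed.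

Lemma supportZ t x : 0 < t -> support_fun L (t *: x) = t * support_fun L x.
Proof.
move=> t0; apply/le_anti/andP; split.
  by apply: support_le => y Ly; rewrite dotpZr ler_pM2l// dotp_le_support.
rewrite -ler_pdivlMl//; apply: support_le => y Ly.
by rewrite ler_pdivlMl// -dotpZr dotp_le_support.
Qed.

Lemma support_gt0 x : x != 0 -> 0 < support_fun L x.
Proof.
move=> x0; have [_ _] := L0; rewrite /interior => /nbhs_ballP[e /= e0 eL].
have nx0 : 0 < `|x| by rewrite normr_gt0.
(* The multiple [s *: x] has norm [e / 2], so it lies in the ball contained in [L], and its inner
   product with [x] is positive. *)
pose s := e / 2 / `|x|.
have s0 : 0 < s by rewrite !divr_gt0.
have Lsx : L (s *: x).
  apply: eL; rewrite -ball_normE/= sub0r normrN normrZ gtr0_norm//.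
  by rewrite /s divfK ?gt_eqF// ltr_pdivrMr// ltr_pMr// ltr1n.
apply: lt_le_trans (dotp_le_support x _ Lsx).
by rewrite dotpZl mulr_gt0// dotp_gt0.
Qed.

(** Boundedness of the body makes its support function Lipschitz. *)
Lemma support_continuous : continuous (support_fun L).
Proof.
have [C C0 LC] := dotp_le_norm.
have lip x z : support_fun L x <= support_fun L z + C * `|x - z|.
  apply: support_le => y Ly; rewrite -[x in dotp y x](subrK z) dotpDr addrC.
  by rewrite lerD ?dotp_le_support ?LC.
move=> x; apply/(@cvgrPdist_le _ _ _ (nbhs x)) => e e0; near=> z.
apply: (@le_trans _ _ (C * `|x - z|)).
  by rewrite ler_distlC lerBlDr lip/= distrC lip.
rewrite -ler_pdivlMl//.
near: z; apply/nbhs_ballP; exists (C^-1 * e) => /= [|z].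
  by rewrite mulr_gt0// invr_gt0.
by rewrite -ball_normE => /ltW.
Unshelve. all: by end_near. Qed.

(** This presents the polar body as a unit sublevel set, the form to which the volume formula and
    the star body criterion apply. *)
Lemma polar_support : polar L = [set x | support_fun L x <= 1].
Proof.
apply/seteqP; split => [x xL|x /= xL y Ly].
  by apply: support_le => y Ly; rewrite dotpC xL.
by apply: le_trans xL; rewrite dotpC dotp_le_support.
Qed.

Lemma support_sphere_le :
  exists2 C, 0 < C & forall u, sphere u -> support_fun L u <= C.
Proof.
have [C C0 LC] := convex_body_coord_bounded.
exists (n.+1%:R * C) => [|u su]; first by rewrite mulr_gt0.
apply: support_le => y Ly; apply: (@le_trans _ _ (\sum_(i < n) C)).
  apply: ler_sum => i _; apply: le_trans (ler_norm _) _.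
  rewrite normrM -[leRHS]mulr1 ler_pM ?LC//.
  by have := coord_le_enorm u i; rewrite su.
by rewrite sumr_const card_ord -[leLHS]mulr_natl ler_wpM2r ?(ltW C0)// ler_nat.
Qed.

End support_function.

Lemma sphere_neq0 (R : realType) n (u : 'rV[R]_n) : sphere u -> u != 0.
Proof. by rewrite -enorm_eq0 => ->; rewrite oner_eq0. Qed.

(** * Unit sublevel sets as star bodies *)

Section sublevel_star_body.
Context {R : realType} {n : nat} (H : 'rV[R]_n -> R).
Hypotheses (HZ : forall l x, 0 < l -> H (l *: x) = l * H x)
  (H_gt0 : forall u, sphere u -> 0 < H u)
  (H_cont : forall u, sphere u -> {for u, continuous H}).

Let H0 : H 0 = 0.
Proof.
(* Homogeneity is assumed for positive factors; the factor 2 gives [H 0 = H 0 + H 0]. *)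
have := HZ 2 0 (ltr0Sn R 1); rewrite scaler0 mulr_natl mulr2n => /eqP.
by rewrite -[eqbLHS]addr0 => /eqP/addrI.
Qed.

Lemma radial_set_sublevel u : sphere u ->
  radial_set [set x | H x <= 1] u = `[0, (H u)^-1]%classic.
Proof.
move=> su; apply/seteqP; split => l; rewrite /radial_set/= in_itv/=.
  move=> []; rewrite {1}le_eqVlt => /predU1P[<- _|l0].
    by rewrite lexx invr_ge0 ltW// H_gt0.
  by rewrite HZ// -ler_pdivlMr ?H_gt0// mul1r (ltW l0).
move=> /andP[l0 lH]; split => //.
move: l0; rewrite le_eqVlt => /predU1P[<-|l0]; first by rewrite scale0r H0 ler01.
by rewrite HZ// -ler_pdivlMr ?H_gt0// mul1r.
Qed.

Lemma radial_fun_sublevel u : sphere u ->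
  radial_fun [set x | H x <= 1] u = (H u)^-1.
Proof.
move=> su; rewrite /radial_fun radial_set_sublevel// sup_itvcc//.
by rewrite invr_ge0 ltW// H_gt0.
Qed.

Lemma star_bodies0_sublevel : star_bodies0 [set x | H x <= 1].
Proof.
split.
- move=> x t /= Hx /andP[]; rewrite le_eqVlt => /predU1P[<- _|t0 t1].
    by rewrite scale0r H0 ler01.
  rewrite HZ//; apply: le_trans t1; rewrite -[leRHS]mulr1.
  by rewrite ler_pM2l.
- move=> u su; rewrite radial_fun_sublevel// radial_set_sublevel//.
  split; first by rewrite /= in_itv/= lexx andbT invr_ge0 ltW// H_gt0.
  by move=> l; rewrite /= in_itv/= => /andP[].
- by move=> u su; rewrite radial_fun_sublevel// invr_gt0 H_gt0.
- apply: (@subspace_eq_continuous _ _ _ (fun u => (H u)^-1)).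
    by move=> u; rewrite inE => su; exact/esym/radial_fun_sublevel.
  apply: continuous_in_subspaceT => u; rewrite inE => su.
  by apply: continuousV; [rewrite gt_eqF// H_gt0|exact: H_cont].
Qed.

End sublevel_star_body.

(** * Powers of real and extended real numbers *)

Section powers.
Context {R : realType}.

Lemma powR_prod (I : Type) (s : seq I) (P : pred I) (f : I -> R) a :
  (forall i, 0 <= f i) ->
  (\prod_(i <- s | P i) f i) `^ a = \prod_(i <- s | P i) f i `^ a.
Proof.
move=> f0; elim: s => [|i s IH]; first by rewrite !big_nil powR1.
by rewrite !big_cons; case: ifP => // _; rewrite powRM ?IH ?prodr_ge0.
Qed.

Lemma poweR_prod (I : Type) (s : seq I) (P : pred I) (f : I -> \bar R) a :
  (forall i, 0 <= f i)%E ->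
  ((\prod_(i <- s | P i) f i) `^ a = \prod_(i <- s | P i) f i `^ a)%E.
Proof.
move=> f0; elim: s => [|i s IH]; first by rewrite !big_nil poweR1r.
by rewrite !big_cons; case: ifP => // _; rewrite poweRM ?IH ?prode_ge0.
Qed.

Lemma powRV (x a : R) : 0 < x -> x^-1 `^ a = x `^ (- a).
Proof.
by move=> x0; rewrite -(powR_inv1 (ltW x0)) -powRrM mulN1r.
Qed.

Lemma prod_powR_inv n (x : R) : (0 < n)%N -> 0 <= x ->
  \prod_(i < n) x `^ n%:R^-1 = x.
Proof.
move=> n0 x0; rewrite prodr_const card_ord -powR_mulrn ?powR_ge0//.
by rewrite -powRrM mulVf ?powRr1// pnatr_eq0 -lt0n.
Qed.

Lemma powR_continuous_gt0 (x a : R) : 0 < x -> {for x, continuous (fun y => y `^ a)}.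
Proof.
move=> x0; apply: differentiable_continuous; apply/derivable1_diffP.
by apply: derivable_powR; rewrite in_itv/= x0.
Qed.

Lemma epow_ge0 (x : \bar R) a : (0 <= epow x a)%E.
Proof.
rewrite /epow; case: ifP => _; last exact: poweR_ge0.
by do 2 case: ifP => // _; exact: poweR_ge0.
Qed.

Lemma epow_pos (x : \bar R) a : 0 <= a -> epow x a = (x `^ a)%E.
Proof. by rewrite /epow leNgt => /negbTE ->. Qed.

(** Identifies the volume factor of a constant tuple with that of the single body. *)
Lemma prod_epow_const n (x : \bar R) a : (0 < n)%N -> 0 < a ->
  (\prod_(i < n) epow x (a / n%:R) = epow x a)%E.
Proof.
move=> n0 a0; have N0 : 0 < n%:R :> R by rewrite ltr0n.
have c0 : 0 < a / n%:R by rewrite divr_gt0.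
rewrite !epow_pos ?(ltW a0) ?(ltW c0)//.
suff prodX m c : 0 < c -> (\prod_(i < m) x `^ c = x `^ (c * m%:R))%E.
  by rewrite prodX// divfK// gt_eqF.
elim: m c => [|m IH] c cp; first by rewrite big_ord0 mulr0 poweRe0.
(* Adding exponents is safe for the bases 0 and infinity as well, since the total exponent is
   nonzero. *)
rewrite big_ord_recr/= IH// -natr1 mulrDr mulr1 poweRD// add_neq0_poweRD_def//.
by rewrite gt_eqF// ltr_wpDl// mulr_ge0// ltW.
Qed.

Section geometric_mean.
Context {n : nat} (v : \bar R) (w : 'I_n -> \bar R) (a : R).
Hypotheses (n_gt0 : (0 < n)%N) (v0 : (0 <= v)%E) (w0 : (forall i, 0 <= w i)%E)
  (vw : (v <= \prod_i w i `^ n%:R^-1)%E).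

Let N0 : 0 < n%:R :> R. Proof. by rewrite ltr0n. Qed.

(** A positive power is increasing, so the bound [vw] passes through it and the exponents [n%:R^-1]
    and [a] combine. *)
Lemma epow_le_prod : 0 < a -> (epow v a <= \prod_i epow (w i) (a / n%:R))%E.
Proof.
move=> a0; rewrite epow_pos ?(ltW a0)//.
apply: (@le_trans _ _ ((\prod_i w i `^ n%:R^-1) `^ a)%E).
  apply: gt0_ler_poweR => //; rewrite ?(ltW a0)// in_itv/= leey andbT//.
  by apply: prode_ge0 => i _; exact: poweR_ge0.
rewrite poweR_prod; last by move=> i; exact: poweR_ge0.
rewrite le_eqVlt; apply/orP; left; apply/eqP; apply: eq_bigr => i _.
by rewrite epow_pos ?divr_ge0 ?(ltW a0) ?(ltW N0)// -poweRrM mulrC.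
Qed.

(** A negative power reverses the bound [vw]. The values 0 and infinity are settled first, by the
    conventions of [epow]; what remains is an inequality between positive reals. *)
Lemma prod_le_epow : a < 0 -> (\prod_i epow (w i) (a / n%:R) <= epow v a)%E.
Proof.
move=> a0; have c0 : a / n%:R < 0 by rewrite pmulr_llt0 ?invr_gt0.
have [v_eq0|v_neq0] := eqVneq v 0%E; first by rewrite /epow a0 v_eq0 eqxx leey.
have v_gt0 : (0 < v)%E by rewrite lt_def v_neq0.
(* A vanishing [w i] would force [v = 0]; hence no factor on the left is infinite. *)
have w_gt0 i : (0 < w i)%E.
  rewrite lt_def w0 andbT; apply/eqP => wi0.
  move: (lt_le_trans v_gt0 vw); rewrite (bigD1 i)//= wi0 poweR0r ?mul0e ?ltxx//.
  by rewrite gt_eqF// invr_gt0.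
(* A negative power of infinity is 0, so an infinite [w i] annihilates the left-hand product. *)
have [[i wioo]|/forallNP wNoo] := pselect (exists i, w i = +oo%E).
  by rewrite (bigD1 i)//= /epow c0 wioo/= mul0e; exact: epow_ge0.
pose r i := fine (w i).
have wE i : w i = (r i)%:E by rewrite fineK// ge0_fin_numE// ltey; exact/eqP/wNoo.
have r_gt0 i : 0 < r i by rewrite -lte_fin -wE.
have prodE : (\prod_i w i `^ n%:R^-1 = (\prod_i r i `^ n%:R^-1)%:E)%E.
  by rewrite -prodEFin; apply: eq_bigr => i _; rewrite wE.
have v_fin : v \is a fin_num.
  by rewrite ge0_fin_numE//; apply: le_lt_trans vw _; rewrite prodE ltry.
move: v_gt0 vw; rewrite -(fineK v_fin) prodE; set s := fine v.
rewrite lte_fin lee_fin => s_gt0 sr.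
rewrite (eq_bigr (fun i => (r i `^ (a / n%:R))%:E)); last first.
  by move=> i _; rewrite wE /epow c0 eqe gt_eqF.
rewrite prodEFin /epow a0 eqe gt_eqF// lee_fin.
rewrite (eq_bigr (fun i => (r i `^ n%:R^-1) `^ a)); last first.
  by move=> i _; rewrite -powRrM mulrC.
rewrite -powR_prod; last by move=> i; exact: powR_ge0.
rewrite -[a]opprK (powRN _ (- a)) (powRN s (- a)).
have pa : 0 < - a by rewrite oppr_gt0.
rewrite lef_pV2 ?posrE ?powR_gt0 ?(lt_le_trans s_gt0 sr)//.
by apply: ge0_ler_powR; rewrite ?nnegrE ?(ltW pa) ?(ltW s_gt0)// (le_trans (ltW s_gt0)).
Qed.

End geometric_mean.
End powers.

Lemma Lp_curvature_fun_ge0 (R : realType) n p (K : set 'rV[R]_n) u :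
  sphere u -> 0 <= Lp_curvature_fun p K u.
Proof.
move=> su; rewrite mulr_ge0 ?powR_ge0// /curvature_fun.
(* A selected density is nonnegative by definition, and the default value of [xget] is the zero
   function. *)
by case: xgetP => [f _ [_ f0 _]|//]; exact: f0.
Qed.

(** * The star body attached to a tuple of convex bodies *)

Section mixed_polar.
Context {R : realType} {n : nat} (n_gt0 : (0 < n)%N).
Implicit Types (K L M : 'I_n -> set 'rV[R]_n).
Local Notation N := (n%:R : R).

Let N0 : 0 < N. Proof. by rewrite ltr0n. Qed.

(** The mean is the geometric one. It is positively homogeneous but need not be convex, so its unit
    sublevel set is treated as a star body. *)
Definition mean_support L (x : 'rV[R]_n) : R :=
  \prod_i support_fun (L i) x `^ N^-1.

Definition mixed_polar L : set 'rV[R]_n := [set x | mean_support L x <= 1].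

Section bodies.
Variables (L : 'I_n -> set 'rV[R]_n) (L0 : forall i, convex_bodies0 (L i)).

Lemma mean_supportZ l x : 0 < l ->
  mean_support L (l *: x) = l * mean_support L x.
Proof.
move=> l0; rewrite -[in RHS](prod_powR_inv n l n_gt0 (ltW l0)) -big_split/=.
apply: eq_bigr => i _; rewrite supportZ// powRM ?(ltW l0)//.
exact: support_ge0.
Qed.

Lemma mean_support_gt0 u : sphere u -> 0 < mean_support L u.
Proof.
move=> su; apply: prodr_gt0 => i _; apply/powR_gt0/support_gt0 => //.
exact: sphere_neq0.
Qed.

(** Continuity of the power is taken at positive values, hence the restriction to the sphere, where
    every support function is positive. *)
Lemma mean_support_continuous u : sphere u -> {for u, continuous (mean_support L)}.
Proof.
move=> su; rewrite /prop_for /continuous_at /mean_support.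
apply: (@cvg_big _ _ _ _ _ _ _ (nbhs u) _ _ _ (nbhs_filter u)) => [z|i _].
  exact: mul_continuous.
apply: (continuous_comp (f := support_fun (L i)) (g := fun y => y `^ N^-1)).
  exact: support_continuous.
by apply/powR_continuous_gt0/support_gt0 => //; exact: sphere_neq0.
Qed.

Lemma measurable_mean_support : measurable_fun setT (mean_support L).
Proof.
apply: measurable_prod => i _; apply: measurableT_comp (measurable_powR _) _.
by apply: continuous_measurable_rV; apply: support_continuous; exact: L0.
Qed.

Lemma mean_support_sphere_le :
  exists2 C, 0 < C & forall u, sphere u -> mean_support L u <= C.
Proof.
have /choice[C LC] : forall i, exists C, 0 < C /\
    forall u, sphere u -> support_fun (L i) u <= C.
  by move=> i; have [C C0 LC] := support_sphere_le _ (L0 i); exists C.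
exists (\prod_i C i `^ N^-1).
  by apply: prodr_gt0 => i _; apply: powR_gt0; have [] := LC i.
move=> u su; apply: ler_prod => i _; rewrite powR_ge0/=.
have [C0 {}LC] := LC i; have s0 := support_ge0 _ (L0 i) u.
by rewrite ge0_ler_powR ?invr_ge0 ?nnegrE ?(ltW C0) ?(ltW N0)// LC.
Qed.

Lemma star_bodies0_mixed_polar : star_bodies0 (mixed_polar L).
Proof.
apply: star_bodies0_sublevel.
- exact: mean_supportZ.
- exact: mean_support_gt0.
- exact: mean_support_continuous.
Qed.

Lemma radial_fun_mixed_polar u : sphere u ->
  radial_fun (mixed_polar L) u = (mean_support L u)^-1.
Proof.
apply: radial_fun_sublevel.
- exact: mean_supportZ.
- exact: mean_support_gt0.
Qed.

End bodies.

Lemma mean_support_cst (L : set 'rV[R]_n) : convex_bodies0 L ->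
  mean_support (fun=> L) = support_fun L.
Proof.
by move=> L0; apply/funext => x; apply: prod_powR_inv => //; exact: support_ge0.
Qed.

Lemma mixed_polar_cst (L : set 'rV[R]_n) : convex_bodies0 L ->
  mixed_polar (fun=> L) = polar L.
Proof. by move=> L0; rewrite polar_support// /mixed_polar mean_support_cst. Qed.

Lemma star_bodies0_polar (L : set 'rV[R]_n) : convex_bodies0 L ->
  star_bodies0 (polar L).
Proof. by move=> L0; rewrite -mixed_polar_cst//; exact: star_bodies0_mixed_polar. Qed.

Lemma radial_fun_polar (L : set 'rV[R]_n) u : convex_bodies0 L -> sphere u ->
  radial_fun (polar L) u = (support_fun L u)^-1.
Proof.
by move=> L0 su; rewrite -mixed_polar_cst// radial_fun_mixed_polar// mean_support_cst.
Qed.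

Section bodies.
Variables (L : 'I_n -> set 'rV[R]_n) (L0 : forall i, convex_bodies0 (L i)).

(** By polar coordinates: the n-th power of the radius removes the n-th roots in the geometric mean
    and leaves the product of the radial functions of the polars. *)
Lemma volume_mixed_polar : volume (mixed_polar L) = dual_mixed_volume_polar L.
Proof.
have [C C0 LC] := mean_support_sphere_le _ L0.
rewrite /mixed_polar (volume_sublevel n_gt0 (mean_support L) C)//.
- congr (_ * _)%E; apply: eq_integral => u; rewrite inE => su; congr EFin.
  rewrite -prodfV -prodrXl; apply: eq_bigr => i _.
  rewrite radial_fun_polar// exprVn -powR_mulrn ?powR_ge0//.
  by rewrite -powRrM mulVf ?gt_eqF// powRr1//; exact: support_ge0.
- exact: measurable_mean_support.
- exact: mean_supportZ.
- exact: mean_support_gt0.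
Qed.

Lemma dual_mixed_volume_polar_ge0 : (0 <= dual_mixed_volume_polar L)%E.
Proof. by rewrite -volume_mixed_polar measure_ge0. Qed.

End bodies.

Lemma volume_polarE (L : set 'rV[R]_n) : convex_bodies0 L ->
  volume (polar L) = (N^-1%:E *
    \int[spherical_measure]_(u in sphere) ((support_fun L u)^-1 ^+ n)%:E)%E.
Proof.
move=> L0; rewrite -mixed_polar_cst// volume_mixed_polar//; congr (_ * _)%E.
apply: eq_integral => u; rewrite inE => su.
by rewrite prodr_const card_ord radial_fun_polar.
Qed.

Section bodies.
Variables (L : 'I_n -> set 'rV[R]_n) (L0 : forall i, convex_bodies0 (L i)).

(** Hoelder's inequality for the radial functions of the polars, the integrals of whose n-th powers
    are the volumes of the polars by polar coordinates. *)
Lemma dual_mixed_volume_le :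
  (dual_mixed_volume_polar L <= \prod_i volume (polar (L i)) `^ N^-1)%E.
Proof.
have Ninv0 : 0 <= N^-1 by rewrite invr_ge0 ltW.
(* Working with the spherical measure divided by [n] absorbs the factor [N^-1] on both sides at
   once. *)
pose m : {measure set 'rV[R]_n -> \bar R} :=
  mscale (NngNum Ninv0) (@spherical_measure R n).
pose f i u := (support_fun (L i) u)^-1.
have f0 i u : sphere u -> 0 <= f i u.
  by move=> su; rewrite invr_ge0; exact: support_ge0.
have mf i : measurable_fun sphere (f i).
  apply: measurable_fun_inv; apply: measurable_funTS.
  by apply: continuous_measurable_rV; apply: support_continuous; exact: L0.
have mS : measurable (@sphere R n) by exact: measurable_sphere.
have mE (g : 'rV[R]_n -> R) : measurable_fun sphere g ->
    (forall u, sphere u -> 0 <= g u) ->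
    (\int[m]_(u in sphere) (g u)%:E =
     N^-1%:E * \int[spherical_measure]_(u in sphere) (g u)%:E)%E.
  move=> mg g0; rewrite ge0_integral_mscale//; first exact/measurable_EFinP.
have := hoelder_prod _ _ m sphere n f n_gt0 mS mf f0.
rewrite (mE (fun u => \prod_i f i u)); last 2 first.
- exact: measurable_prod.
- by move=> u su; apply: prodr_ge0 => i _; exact: f0.
move=> h; apply: le_trans (le_trans _ h) _; rewrite le_eqVlt; apply/orP; left; apply/eqP.
  congr (_ * _)%E; apply: eq_integral => u; rewrite inE => su; congr EFin.
  by apply: eq_bigr => i _; rewrite radial_fun_polar.
apply: eq_bigr => i _; rewrite (mE (fun u => f i u ^+ n)) ?volume_polarE//.
- exact: measurable_funX.
- by move=> u su; rewrite exprn_ge0// f0.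
Qed.

Lemma Vp_polarE p K : Vp_polar p K (fun i => polar (L i)) = Vp p K L.
Proof.
rewrite /Vp_polar /Vp; apply: (congr1 (fun z => _ * z)%E).
apply: eq_integral => u; rewrite inE => su.
apply: (congr1 EFin).
apply: eq_bigr => i _; rewrite radial_fun_polar//.
by rewrite powRV ?opprK//; apply: support_gt0 => //; exact: sphere_neq0.
Qed.

Lemma Vp_mixed_polar p K : Vp_polar p K (fun=> mixed_polar L) = Vp p K L.
Proof.
rewrite /Vp_polar /Vp; apply: (congr1 (fun z => _ * z)%E).
apply: eq_integral => u; rewrite inE => su.
apply: (congr1 EFin).
have sL0 i : 0 <= support_fun (L i) u by exact: support_ge0.
have F0 i := Lp_curvature_fun_ge0 _ _ p (K i) u su.
have G0 := mean_support_gt0 L L0 u su.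
rewrite (radial_fun_mixed_polar L L0 u su) (powRV _ _ G0) opprK.
(* The [n] equal factors of exponent [N^-1] recombine into the full p-th power of the geometric
   mean, which is then redistributed over the support functions of the [L i]. *)
transitivity (mean_support L u `^ p * \prod_i Lp_curvature_fun p (K i) u `^ N^-1).
  rewrite -[X in _ = X * _](prod_powR_inv n) ?powR_ge0// -big_split/=.
  by apply: eq_bigr => i _; rewrite powRM ?powR_ge0.
rewrite powR_prod; last by move=> i; exact: powR_ge0.
rewrite -big_split/=; apply: eq_bigr => i _.
by rewrite powRM ?powR_ge0// powRAC.
Qed.

End bodies.
End mixed_polar.

(** * Comparing extrema through their competitors *)

Section comparison.
Context {R : realType}.
Implicit Types (S T : set (\bar R)) (p : R).
Local Open Scope ereal_scope.

Lemma inf_or_sup_pos p S T : (0 < p)%R ->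
  (forall y, T y -> exists2 x, S x & x <= y) -> inf_or_sup p S <= inf_or_sup p T.
Proof.
move=> p0 ST; rewrite /inf_or_sup p0; apply: le_ereal_inf_tmp => y /ST[x Sx xy].
by apply: ge_ereal_inf; exists x.
Qed.

Lemma inf_or_sup_neg p S T : (p < 0)%R ->
  (forall y, T y -> exists2 x, S x & y <= x) -> inf_or_sup p T <= inf_or_sup p S.
Proof.
move=> p0 ST; rewrite /inf_or_sup ltNge (ltW p0)/=.
apply: ge_ereal_sup => y /ST[x Sx xy].
by apply: le_ereal_sup_tmp; exists x.
Qed.

End comparison.

(** * Affine against geominimal surface areas *)

Section area_comparison.
Context {R : realType} {n : nat} (n_gt0 : (0 < n)%N)
  (K : 'I_n -> set 'rV[R]_n).
Local Notation N := (n%:R : R).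
Local Open Scope ereal_scope.

Let N0 : (0 < N)%R. Proof. by rewrite ltr0n. Qed.

Definition affine_values p : set (\bar R) :=
  [set N%:E * epow (Vp_polar p K (fun=> L)) (N / (N + p))
       * epow (volume L) (p / (N + p)) | L in star_bodies0].

Lemma affine_areaE p : p != 0%R ->
  affine_area p K = inf_or_sup p (affine_values p).
Proof. by rewrite /affine_area => /negbTE ->. Qed.

Lemma affine_values_polar p (L : set 'rV[R]_n) : convex_bodies0 L ->
  affine_values p (N%:E * epow (Vp p K (fun=> L)) (N / (N + p))
                       * epow (volume (polar L)) (p / (N + p))).
Proof.
move=> L0; exists (polar L); first exact: star_bodies0_polar.
by rewrite (Vp_polarE n_gt0 (fun=> L)).
Qed.

Lemma affine_values_mixed_polar p (L : 'I_n -> set 'rV[R]_n) :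
  (forall i, convex_bodies0 (L i)) ->
  affine_values p (N%:E * epow (Vp p K L) (N / (N + p))
                       * epow (dual_mixed_volume_polar L) (p / (N + p))).
Proof.
move=> L0; exists (mixed_polar L); first exact: star_bodies0_mixed_polar.
by rewrite (Vp_mixed_polar n_gt0 L L0) (volume_mixed_polar n_gt0 L L0).
Qed.

Let area_factor_ge0 (x : \bar R) c : 0 <= N%:E * epow x c.
Proof. by rewrite mule_ge0 ?epow_ge0// lee_fin ler0n. Qed.

Let exponentE p : (p / ((N + p) * N) = p / (N + p) / N)%R.
Proof. by rewrite invfM mulrA. Qed.

Lemma affine_area_le p : (0 <= p)%R ->
  [/\ affine_area p K <= geominimal1 p K,
      affine_area p K <= geominimal2 p K &
      affine_area p K <= geominimal3 p K].
Proof.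
rewrite le_eqVlt => /predU1P[<-|p0].
  by rewrite /affine_area /geominimal1 /geominimal2 /geominimal3 eqxx.
have pN0 : p != 0%R by rewrite gt_eqF.
have a0 : (0 < p / (N + p))%R by rewrite divr_gt0// addr_gt0.
rewrite affine_areaE// /geominimal1 /geominimal2 /geominimal3 (negbTE pN0).
split; apply: inf_or_sup_pos => // _ [L L0 <-].
- by eexists; first exact: (affine_values_polar p L L0).
(* The competitor is the mixed polar body. As [p / (N + p)] is positive, Hoelder's bound on its
   volume yields a smaller value, as an infimum requires. *)
- eexists; first exact: (affine_values_mixed_polar p L L0).
  apply: lee_wpmul2l; first exact: area_factor_ge0.
  rewrite exponentE; apply: epow_le_prod => //.
  + exact: (dual_mixed_volume_polar_ge0 n_gt0 L L0).
  + exact: (dual_mixed_volume_le n_gt0 L L0).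
- by eexists; first exact: (affine_values_mixed_polar p L L0).
Qed.

Lemma geominimal1_le p : (p < 0)%R -> geominimal1 p K <= affine_area p K.
Proof.
move=> p0; have pN0 : p != 0%R by rewrite lt_eqF.
rewrite affine_areaE// /geominimal1 (negbTE pN0).
apply: inf_or_sup_neg => // _ [L L0 <-].
by eexists; first exact: (affine_values_polar p L L0).
Qed.

Lemma geominimal3_le p : (p < 0)%R -> geominimal3 p K <= affine_area p K.
Proof.
move=> p0; have pN0 : p != 0%R by rewrite lt_eqF.
rewrite affine_areaE// /geominimal3 (negbTE pN0).
apply: inf_or_sup_neg => // _ [L L0 <-].
by eexists; first exact: (affine_values_mixed_polar p L L0).
Qed.

Lemma geominimal2_le p : (- N < p)%R -> (p < 0)%R ->
  geominimal2 p K <= affine_area p K.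
Proof.
move=> Np p0; have pN0 : p != 0%R by rewrite lt_eqF.
(* Here [N + p] is positive and [p] negative; the negative exponent reverses Hoelder's bound, which
   is the direction a supremum requires. *)
have a0 : (p / (N + p) < 0)%R.
  by rewrite pmulr_llt0// invr_gt0 -ltrBlDl sub0r.
rewrite affine_areaE// /geominimal2 (negbTE pN0).
apply: inf_or_sup_neg => // _ [L L0 <-].
eexists; first exact: (affine_values_mixed_polar p L L0).
apply: lee_wpmul2l; first exact: area_factor_ge0.
rewrite exponentE; apply: prod_le_epow => //.
- exact: (dual_mixed_volume_polar_ge0 n_gt0 L L0).
- exact: (dual_mixed_volume_le n_gt0 L L0).
Qed.

(** Constant tuples are among the competitors on the right and give the values on the left. Both [p]
    and [N + p] are negative, so the volume exponent is positive. *)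
Lemma affine_area_le_affine_area1 p : (p < - N)%R ->
  affine_area p K <= affine_area1 p K.
Proof.
move=> pN; have p0 : (p < 0)%R by rewrite (lt_trans pN)// oppr_lt0.
have a0 : (0 < p / (N + p))%R.
  by rewrite nmulr_rgt0// invr_lt0 -ltrBrDl sub0r.
rewrite affine_areaE ?lt_eqF// /inf_or_sup ltNge (ltW p0)/=.
apply: ereal_sup_le => _ [L L0 <-]; exists (fun=> L) => //.
by rewrite exponentE prod_epow_const.
Qed.

(** The tuple of polars is itself a competitor with the same value. *)
Lemma geominimal2_le_affine_area1 p : (p < 0)%R ->
  geominimal2 p K <= affine_area1 p K.
Proof.
move=> p0; rewrite /geominimal2 lt_eqF// /inf_or_sup ltNge (ltW p0)/=.
apply: ereal_sup_le => _ [L L0 <-]; exists (fun i => polar (L i)).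
  by move=> i; exact: star_bodies0_polar.
by rewrite (Vp_polarE n_gt0 L L0).
Qed.

End area_comparison.

Theorem proposition4p3 (R : realType) (n : nat) (n_gt0 : (0 < n)%N)
    (K : 'I_n -> set 'rV[R]_n) (KF0 : forall i, convex_bodiesF0 (K i)) :
  [/\ forall p : R, 0 <= p ->
        [/\ (affine_area p K <= geominimal1 p K)%E,
            (affine_area p K <= geominimal2 p K)%E &
            (affine_area p K <= geominimal3 p K)%E],
      forall p : R, - n%:R < p -> p < 0 ->
        [/\ (affine_area p K >= geominimal1 p K)%E,
            (affine_area p K >= geominimal2 p K)%E &
            (affine_area p K >= geominimal3 p K)%E] &
      forall p : R, p < - n%:R ->
        [/\ (affine_area p K >= geominimal1 p K)%E,
            (affine_area p K >= geominimal3 p K)%E,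
            (affine_area1 p K >= geominimal1 p K)%E,
            (affine_area1 p K >= geominimal2 p K)%E &
            (affine_area1 p K >= geominimal3 p K)%E]].
Proof.
split=> [p p0|p Np p0|p pN].
- exact: affine_area_le.
- by split; [exact: geominimal1_le|exact: geominimal2_le|exact: geominimal3_le].
- have p0 : p < 0 by rewrite (lt_le_trans pN)// oppr_le0.
  (* The first and third geominimal areas reach [affine_area1] through [affine_area]; the second is
     compared with it directly. *)
  have le1 := affine_area_le_affine_area1 n_gt0 K p pN.
  have G1 := geominimal1_le n_gt0 K p p0.
  have G3 := geominimal3_le n_gt0 K p p0.
  split=> //; [exact: le_trans le1| |exact: le_trans le1].
  exact: geominimal2_le_affine_area1.
Qed.
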